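(* Let $(\Theta,\mathcal B,\mu_0)$ be a probability space and let $\mathcal L_N,\mathcal L:\Theta\to\mathbb R$ ($N\in\mathbb N$) be measurable. Suppose $$\|\mathcal L_N-\mathcal L\|_{L^\infty(\mu_0)}\le\varepsilon_N$$ for real numbers $\varepsilon_N\ge 0$, and $$0<Z=\int_\Theta\exp[-\mathcal L(\theta)]\,\mu_0(d\theta)<\infty .$$ Define $Z_N=\int_\Theta\exp[-\mathcal L_N(\theta)]\,\mu_0(d\theta)$ and $$\frac{d\pi_N}{d\mu_0}=Z_N^{-1}\exp[-\mathcal L_N],\qquad\frac{d\pi}{d\mu_0}=Z^{-1}\exp[-\mathcal L].$$ Then $0<Z_N<\infty$ and $$\exp(-\varepsilon_N)\le\frac{Z_N}{Z}\le\exp(\varepsilon_N).$$ Moreover, $$\|\pi_N-\pi\|_{\mathrm{TV}}\le\tfrac12\bigl[\exp(2\varepsilon_N)-1\bigr],\qquad d_{\mathrm{Hell}}(\pi_N,\pi)\le\tfrac1{\sqrt2}\bigl[\exp(\varepsilon_N)-1\bigr],$$ and for every bounded measurable $Q:\Theta\to\mathbb R$, $$\bigl|\mathbb E_{\pi_N}[Q]-\mathbb E_\pi[Q]\bigr|\le\|Q\|_{L^\infty}\bigl[\exp(2\varepsilon_N)-1\bigr].$$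
   Context: Total variation is normalized as $\|\pi_N-\pi\|_{\mathrm{TV}}=\sup_{A\in\mathcal B}|\pi_N(A)-\pi(A)|=\frac12\int_\Theta\left|\frac{d\pi_N}{d\mu_0}-\frac{d\pi}{d\mu_0}\right|d\mu_0$, and the Hellinger distance by $$d_{\mathrm{Hell}}^2(\pi_N,\pi)=\frac12\int_\Theta\left[\sqrt{\frac{d\pi_N}{d\mu_0}}-\sqrt{\frac{d\pi}{d\mu_0}}\right]^2\mu_0(d\theta).$$ *)

(* Defs.v *)
From HB Require Import structures.
From mathcomp Require Import all_boot all_order all_algebra.
From mathcomp Require Import all_classical all_reals all_analysis.
From mathcomp Require Import measurable_realfun.

Set Implicit Arguments.
Unset Strict Implicit.
Unset Printing Implicit Defensive.

Import Order.TTheory GRing.Theory Num.Theory.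
Import numFieldNormedType.Exports.

Local Open Scope classical_set_scope.
Local Open Scope ring_scope.
Local Open Scope ereal_scope.
Local Open Scope charge_scope.

Section posterior.
Context (d : measure_display) (T : measurableType d) (R : realType).
Variables (mu0 : probability T R) (L : {mfun T >-> R}).

Definition evidence : \bar R := \int[mu0]_t (expR (- L t))%:E.

(* [fine] sends +oo to 0, so when the evidence is infinite the density is 0 and
   [posterior] is the zero measure: [posterior] is a finite measure for every L,
   and a probability measure as soon as 0 < evidence < +oo. *)
Definition posterior_density (t : T) : R :=
  ((fine evidence)^-1 * expR (- L t))%R.

Definition posterior (A : set T) : \bar R :=
  \int[mu0]_(t in A) (posterior_density t)%:E.

Lemma evidence_ge0 : 0 <= evidence.
Proof. by apply: integral_ge0 => t _; rewrite lee_fin expR_ge0. Qed.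

Lemma measurable_expRN : measurable_fun [set: T] (fun t => expR (- L t)).
Proof. by do 2 apply: measurableT_comp => //. Qed.

Lemma posterior_density_ge0 t : (0 <= posterior_density t)%R.
Proof.
by rewrite mulr_ge0 ?invr_ge0 ?fine_ge0 ?evidence_ge0 ?expR_ge0.
Qed.

Lemma measurable_posterior_density : measurable_fun [set: T] posterior_density.
Proof. by apply: measurable_funM => //; exact: measurable_expRN. Qed.

Lemma posterior_setTE :
  posterior [set: T] = ((fine evidence)^-1)%:E * evidence.
Proof.
rewrite /posterior /posterior_density.
under eq_integral do rewrite EFinM.
rewrite ge0_integralZl//.
  by apply/measurable_EFinP; exact: measurable_expRN.
by rewrite lee_fin invr_ge0 fine_ge0 ?evidence_ge0.
Qed.

Let posterior0 : posterior set0 = 0.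
Proof. by rewrite /posterior integral_set0. Qed.

Let posterior_ge0 A : 0 <= posterior A.
Proof.
by apply: integral_ge0 => t _; rewrite lee_fin posterior_density_ge0.
Qed.

Let posterior_semi_sigma_additive : semi_sigma_additive posterior.
Proof.
move=> F mF tF mUF; rewrite /posterior ge0_integral_bigcup//=.
- apply: is_cvg_ereal_nneg_natsum_cond => n _ _.
  by apply: integral_ge0 => t _; rewrite lee_fin posterior_density_ge0.
- apply/measurable_EFinP; apply: measurable_funTS.
  exact: measurable_posterior_density.
- by move=> t _; rewrite lee_fin posterior_density_ge0.
Qed.

HB.instance Definition _ := isMeasure.Build _ _ _ posterior
  posterior0 posterior_ge0 posterior_semi_sigma_additive.

Let posterior_fin : fin_num_fun posterior.
Proof.
apply: lty_fin_num_fun; rewrite [ltLHS]posterior_setTE.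
case: evidence => [r| |] /=; first by rewrite -EFinM ltry.
- by rewrite invr0 mul0e ltry.
- by rewrite invr0 mul0e ltry.
Qed.

HB.instance Definition _ := Measure_isFinite.Build _ _ _ posterior
  posterior_fin.

Lemma posterior_setT : 0 < evidence < +oo -> posterior [set: T] = 1.
Proof.
move=> /andP[Z0 Zoo]; rewrite posterior_setTE.
have Zfin : evidence \is a fin_num by rewrite ge0_fin_numE ?evidence_ge0.
rewrite -{2}(fineK Zfin) -EFinM mulVf//.
by rewrite gt_eqF// fine_gt0// Z0.
Qed.

Lemma posterior_dominates : posterior `<< mu0.
Proof.
apply/null_content_dominatesP => A mA A0.
apply: null_set_integral => //.
apply/measurable_EFinP; apply: measurable_funTS.
exact: measurable_posterior_density.
Qed.

Lemma Radon_Nikodym_posterior :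
  ae_eq mu0 [set: T] ('d (charge_of_finite_measure posterior) '/d mu0)
    (EFin \o posterior_density).
Proof.
have dom : charge_of_finite_measure posterior `<< mu0.
  exact: posterior_dominates.
apply: integral_ae_eq => //.
- exact: Radon_Nikodym_integrable.
- by apply/measurable_EFinP; exact: measurable_posterior_density.
- by move=> E _ mE; rewrite -Radon_Nikodym_integral.
Qed.

End posterior.

Section distances.
Context (d : measure_display) (T : measurableType d) (R : realType).

Definition tv_dist (nu1 nu2 : {finite_measure set T -> \bar R}) : \bar R :=
  ereal_sup [set `|nu1 A - nu2 A| | A in measurable].

Definition hellinger_dist (mu : {sigma_finite_measure set T -> \bar R})
    (nu1 nu2 : {finite_measure set T -> \bar R}) : \bar R :=
  let p1 := 'd (charge_of_finite_measure nu1) '/d mu in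
  let p2 := 'd (charge_of_finite_measure nu2) '/d mu in
  sqrte ((2^-1)%:E * \int[mu]_t (sqrte (p1 t) - sqrte (p2 t)) ^+ 2).

End distances.

(* Main.v *)
Require Import Defs.
From HB Require Import structures.
From mathcomp Require Import all_boot all_order all_algebra.
From mathcomp Require Import all_classical all_reals all_analysis.
From mathcomp Require Import measurable_realfun ess_sup_inf ring lra.

Set Implicit Arguments.
Unset Strict Implicit.
Unset Printing Implicit Defensive.

Import Order.TTheory GRing.Theory Num.Theory.
Import numFieldNormedType.Exports.

Local Open Scope classical_set_scope.
Local Open Scope ring_scope.
Local Open Scope ereal_scope.

(** Write e for the bound on the potentials and |K - L| <= e almost everywhere.
    Then exp(-K) and exp(-L) are within a factor exp(e) of each other, in both
    directions; integrating, so are the two evidences. This bounds the ratio of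
    the evidences and shows that one of them is positive and finite as soon as
    the other is. A density is the quotient of these two quantities, so the
    densities p_K and p_L are within a factor exp(2e) of each other
    ([posterior_density_le]), and their square roots within a factor exp(e).

    A ratio bound c gives a distance bound with factor c - 1
    ([dist_le_of_ratio_le]): |p_K - p_L| <= (exp(2e) - 1) p_L and
    |sqrt p_K - sqrt p_L| <= (exp(e) - 1) sqrt p_L almost everywhere. Since p_L
    has integral 1, integrating the square of the second one yields the
    Hellinger estimate, and integrating the first one against a function Q with
    |Q| <= M yields

      |E_K Q - E_L Q| <= M (exp(2e) - 1)     ([expectation_dist]).

    The total variation estimate is the case Q = 1_A - 1/2: both posteriors have
    total mass 1, so the shift by 1/2 leaves the difference of the expectations
    equal to the difference of the masses of A, while it halves the supremum
    norm of the indicator. This is where the factor 1/2 comes from. *)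

(** * Real inequalities *)

(** A two-sided bound c on the ratio of x and y controls their difference. The
    hypothesis y <= c * x gives y - x <= (1 - 1/c) * y, and 1 - 1/c <= c - 1,
    so that the upper ratio dictates the constant on both sides. *)
Lemma dist_le_of_ratio_le (R : realFieldType) (c x y : R) :
  (1 <= c -> 0 <= y -> x <= c * y -> y <= c * x -> `|x - y| <= (c - 1) * y)%R.
Proof.
move=> c1 y0 xy yx; rewrite ler_norml; apply/andP; split; last by lra.
have c0 : (0 < c)%R by lra.
rewrite -subr_ge0 -(pmulr_rge0 _ c0).
(* After multiplication by c, the gap is at least (c - 1)^2 y, by y <= c x. *)
have : (0 <= (c - 1) ^+ 2 * y)%R by rewrite mulr_ge0 ?sqr_ge0.
nra.
Qed.

Lemma expR_ge1 (R : realType) (x : R) : (1 <= expR x)%R = (0 <= x)%R.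
Proof. by rewrite -[leLHS]expR0 ler_expR. Qed.

Lemma expRN_le_of_close (R : realType) (e x y : R) : (`|x - y| <= e)%R ->
  (expR (- x) <= expR e * expR (- y))%R.
Proof. by rewrite -expRD ler_expR ler_norml => /andP[? ?]; lra. Qed.

(** * The essential supremum norm *)

Section ae_close.
Context (d : measure_display) (T : measurableType d) (R : realType).
Variable mu : probability T R.

Lemma ae_le_Lnormy (f : T -> R) :
  {ae mu, forall t, `|f t|%:E <= 'N[mu]_+oo[EFin \o f]}.
Proof.
rewrite unlock /= probability_setT lte01.
exact: (ess_sup_ge mu (abse \o (EFin \o f))).
Qed.

Lemma ae_Lnormy_le (f : T -> R) e : 'N[mu]_+oo[EFin \o f] <= e%:E ->
  {ae mu, forall t, (`|f t| <= e)%R}.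
Proof.
move=> fe; apply: filterS (ae_le_Lnormy f) => t ft.
by rewrite -lee_fin (le_trans ft).
Qed.

Lemma Lnormy_fin_num (f : T -> R) :
  bounded_fun f -> 'N[mu]_+oo[EFin \o f] \is a fin_num.
Proof.
move=> [M [_ fM]]; rewrite ge0_fin_numE ?Lnorm_ge0//.
apply: (@le_lt_trans _ _ (M + 1)%:E); last exact: ltry.
rewrite unlock /= probability_setT lte01.
by apply/ess_supP/nearW => t; rewrite lee_fin fM// ltrDl.
Qed.

End ae_close.

(** * Comparison of the evidences *)

Section stability.
Context (d : measure_display) (T : measurableType d) (R : realType).
Variable mu : probability T R.
Implicit Types (K L : {mfun T >-> R}) (e : R) (Q : T -> R).

Lemma evidence_le_of_close K L e :
  {ae mu, forall t, (`|K t - L t| <= e)%R} ->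
  evidence mu K <= (expR e)%:E * evidence mu L.
Proof.
move=> KL; rewrite /evidence.
rewrite -ge0_integralZl//; last first.
  by apply/measurable_EFinP; exact: measurable_expRN.
apply: ae_ge0_le_integral => //.
- by apply/measurable_EFinP; exact: measurable_expRN.
- by apply: measurable_funeM; apply/measurable_EFinP; exact: measurable_expRN.
- apply: filterS KL => t KLt _.
  by rewrite -EFinM lee_fin expRN_le_of_close.
Qed.

Lemma evidence_fineK L : 0 < evidence mu L < +oo ->
  (fine (evidence mu L))%:E = evidence mu L.
Proof.
by move=> /andP[/ltW ? ?]; rewrite fineK// ge0_fin_numE.
Qed.

Lemma ae_distC K L e : {ae mu, forall t, (`|K t - L t| <= e)%R} ->
  {ae mu, forall t, (`|L t - K t| <= e)%R}.
Proof. by apply: filterS => t; rewrite distrC. Qed.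

(** Closeness is symmetric: one comparison keeps the evidence of K finite, the
    reversed one keeps it from vanishing. *)
Lemma evidence_pos_fin K L e :
  {ae mu, forall t, (`|K t - L t| <= e)%R} ->
  0 < evidence mu L < +oo -> 0 < evidence mu K < +oo.
Proof.
move=> KL /[dup] hL /andP[L0 Loo]; apply/andP; split; last first.
  apply: (le_lt_trans (evidence_le_of_close KL)).
  by rewrite -(evidence_fineK hL) -EFinM ltry.
rewrite lt0e evidence_ge0 andbT; apply/eqP => K0.
have := evidence_le_of_close (ae_distC KL).
by rewrite K0 mule0 leNgt L0.
Qed.

Lemma fine_evidence_le K L e :
  {ae mu, forall t, (`|K t - L t| <= e)%R} -> 0 < evidence mu L < +oo ->
  (fine (evidence mu K) <= expR e * fine (evidence mu L))%R.
Proof.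
move=> KL hL; rewrite -lee_fin EFinM !evidence_fineK//.
  exact: evidence_le_of_close.
exact: evidence_pos_fin KL hL.
Qed.

Lemma fine_evidence_gt0 L : 0 < evidence mu L < +oo ->
  (0 < fine (evidence mu L))%R.
Proof. by move=> /andP[? ?]; rewrite fine_gt0//; apply/andP. Qed.

Lemma evidence_ratio K L e :
  {ae mu, forall t, (`|K t - L t| <= e)%R} -> 0 < evidence mu L < +oo ->
  (expR (- e) <= fine (evidence mu K) / fine (evidence mu L) <= expR e)%R.
Proof.
move=> KL hL; have hK := evidence_pos_fin KL hL.
rewrite ler_pdivlMr ?fine_evidence_gt0// ler_pdivrMr ?fine_evidence_gt0//.
rewrite fine_evidence_le// andbT.
by rewrite expRN mulrC ler_pdivrMr ?expR_gt0// mulrC (fine_evidence_le (ae_distC KL)).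
Qed.

(** * Comparison of the posterior densities *)

(** One factor exp(e) comes from the exponentials and another one from the
    normalizing constants, which may err in the same direction. *)
Lemma posterior_density_le K L e :
  {ae mu, forall t, (`|K t - L t| <= e)%R} -> 0 < evidence mu L < +oo ->
  {ae mu, forall t,
    (posterior_density mu K t <= expR (2 * e) * posterior_density mu L t)%R}.
Proof.
move=> KL hL; have hK := evidence_pos_fin KL hL.
have KL' := KL; apply: filterS KL' => t KLt; rewrite /posterior_density.
have -> : (2 * e = e + e :> R)%R by ring.
rewrite expRD mulrACA ler_pM ?expR_ge0 ?invr_ge0 ?(ltW (fine_evidence_gt0 _))//.
  rewrite ler_pdivlMr ?fine_evidence_gt0// ler_pdivrMl ?fine_evidence_gt0//.
  by rewrite mulrC (fine_evidence_le (ae_distC KL)).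
exact: expRN_le_of_close.
Qed.

Lemma posterior_density_dist K L e : (0 <= e)%R ->
  {ae mu, forall t, (`|K t - L t| <= e)%R} -> 0 < evidence mu L < +oo ->
  {ae mu, forall t,
    (`|posterior_density mu K t - posterior_density mu L t|
     <= (expR (2 * e) - 1) * posterior_density mu L t)%R}.
Proof.
move=> e0 KL hL; have hK := evidence_pos_fin KL hL.
apply: filterS2 (posterior_density_le KL hL)
  (posterior_density_le (ae_distC KL) hK) => t.
apply: dist_le_of_ratio_le; last exact: posterior_density_ge0.
by rewrite expR_ge1 mulr_ge0.
Qed.

(** The ratio bound exp(2e) becomes exp(e) under the square root; bounding the
    difference only after this step is what gives the Hellinger distance the
    exponent e in place of 2e. *)
Lemma sqrt_posterior_density_dist K L e : (0 <= e)%R ->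
  {ae mu, forall t, (`|K t - L t| <= e)%R} -> 0 < evidence mu L < +oo ->
  {ae mu, forall t,
    (`|Num.sqrt (posterior_density mu K t)
       - Num.sqrt (posterior_density mu L t)|
     <= (expR e - 1) * Num.sqrt (posterior_density mu L t))%R}.
Proof.
move=> e0 KL hL; have hK := evidence_pos_fin KL hL.
have sqrt_le (x y : R) : (x <= expR (2 * e) * y ->
    Num.sqrt x <= expR e * Num.sqrt y)%R.
  move=> xy; have -> : (expR e = Num.sqrt (expR (2 * e)) :> R)%R.
    by rewrite mulrDl mul1r expRD -expr2 sqrtr_sqr ger0_norm ?expR_ge0.
  by rewrite -sqrtrM ?expR_ge0 ?ler_wsqrtr.
apply: filterS2 (posterior_density_le KL hL)
  (posterior_density_le (ae_distC KL) hK) => t KLt LKt.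
by apply: dist_le_of_ratio_le; rewrite ?sqrt_le ?expR_ge1 ?sqrtr_ge0.
Qed.

(** * Distances between the posteriors *)

(** The posterior is only given through its values on sets; its expectations
    are reached through its Radon-Nikodym derivative, which agrees almost
    everywhere with the explicit density. *)
Lemma integral_posterior L Q : measurable_fun setT Q -> bounded_fun Q ->
  \int[posterior mu L]_t (Q t)%:E
  = \int[mu]_t (Q t * posterior_density mu L t)%:E.
Proof.
move=> mQ bQ.
rewrite -(Radon_Nikodym_change_of_variables (@posterior_dominates _ _ _ mu L))//.
  apply: ae_eq_integral => //.
  - apply: emeasurable_funM; first exact/measurable_EFinP.
    apply: measurable_int; apply: Radon_Nikodym_integrable.
    exact: posterior_dominates.
  - apply/measurable_EFinP; apply: measurable_funM => //.
    exact: measurable_posterior_density.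
  - apply: filterS (@Radon_Nikodym_posterior _ _ _ mu L) => t /= /(_ I) rn _.
    by rewrite rn EFinM.
apply: measurable_bounded_integrable => //.
by rewrite ltey_eq fin_num_measure.
Qed.

Lemma integral_posterior_density L : 0 < evidence mu L < +oo ->
  \int[mu]_t (posterior_density mu L t)%:E = 1.
Proof. by move=> hL; rewrite -(posterior_setT hL). Qed.

Lemma integrable_posterior_density L : 0 < evidence mu L < +oo ->
  mu.-integrable setT (EFin \o posterior_density mu L).
Proof.
move=> hL; apply/integrableP; split.
  by apply/measurable_EFinP; exact: measurable_posterior_density.
under eq_integral do rewrite /= ger0_norm ?posterior_density_ge0//.
by rewrite integral_posterior_density// ltry.
Qed.

(** The bound M need only hold almost everywhere for mu, since the posteriors
    are absolutely continuous; this lets M be the essential supremum of |Q|. *)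
Lemma expectation_dist K L e Q (M : R) : (0 <= e)%R -> (0 <= M)%R ->
  {ae mu, forall t, (`|K t - L t| <= e)%R} -> 0 < evidence mu L < +oo ->
  measurable_fun setT Q -> bounded_fun Q ->
  {ae mu, forall t, (`|Q t| <= M)%R} ->
  `| \int[posterior mu K]_t (Q t)%:E - \int[posterior mu L]_t (Q t)%:E |
  <= (M * (expR (2 * e) - 1))%:E.
Proof.
move=> e0 M0 KL hL mQ bQ QM; have hK := evidence_pos_fin KL hL.
have c0 : (0 <= expR (2 * e) - 1 :> R)%R by rewrite subr_ge0 expR_ge1 mulr_ge0.
have iQ J : 0 < evidence mu J < +oo ->
    mu.-integrable setT (EFin \o (fun t => Q t * posterior_density mu J t)%R).
  move=> hJ; have := integrableMr measurableT mQ bQ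
    (integrable_posterior_density hJ).
  by apply: eq_integrable.
rewrite !integral_posterior// -integralB_EFin//; try exact: iQ.
apply: le_trans (le_abse_integral _ _ _) _ => //.
  apply: emeasurable_funB; apply: measurable_int.
    exact: iQ hK.
  exact: iQ hL.
(* Integrate |Q| |p_K - p_L| <= M (exp(2e) - 1) p_L, as p_L has mass 1. *)
rewrite -[leRHS]mule1 -(integral_posterior_density hL) -ge0_integralZl//.
- apply: ae_ge0_le_integral => //.
  + apply: measurableT_comp => //.
    apply: emeasurable_funB; apply: measurable_int.
      exact: iQ hK.
    exact: iQ hL.
  + by move=> t _; rewrite -EFinM lee_fin (mulr_ge0 (mulr_ge0 M0 c0))//
      posterior_density_ge0.
  + apply: measurable_funeM; apply/measurable_EFinP.
    exact: measurable_posterior_density.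
  + apply: filterS2 QM (posterior_density_dist e0 KL hL) => t Qt pt _.
    by rewrite -EFinB -EFinM lee_fin -mulrBr normrM -mulrA ler_pM.
- by apply/measurable_EFinP; exact: measurable_posterior_density.
- by move=> t _; rewrite lee_fin posterior_density_ge0.
- by rewrite lee_fin mulr_ge0.
Qed.

(** Centring the indicator of A at 1/2 halves its supremum norm and, the two
    posteriors having the same total mass, does not change the difference of
    the expectations. *)
Lemma tv_dist_posterior K L e : (0 <= e)%R ->
  {ae mu, forall t, (`|K t - L t| <= e)%R} -> 0 < evidence mu L < +oo ->
  tv_dist (posterior mu K) (posterior mu L)
  <= (2^-1 * (expR (2 * e) - 1))%:E.
Proof.
move=> e0 KL hL; have hK := evidence_pos_fin KL hL.
apply: ge_ereal_sup => _ [A mA <-].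
pose Q (t : T) : R := (\1_A t - 2^-1)%R.
have Qhalf t : (`|Q t| <= 2^-1)%R.
  rewrite /Q indicE; case: (t \in A) => /=; rewrite ler_norml; lra.
have mQ : measurable_fun setT Q by apply: measurable_funB.
have bQ : bounded_fun Q.
  exists 2^-1%R; split; first exact: num_real.
  by move=> x hx t _; exact: le_trans (Qhalf t) (ltW hx).
have QE J : 0 < evidence mu J < +oo ->
    \int[posterior mu J]_t (Q t)%:E = posterior mu J A - (2^-1)%:E.
  move=> hJ; rewrite integralB_EFin//; first last.
  - exact: finite_measure_integrable_cst.
  - exact: integrable_indic.
  rewrite integral_indic// setIT integral_cst//.
  by rewrite [X in _ - _ * X](posterior_setT hJ) mule1.
have fin J : posterior mu J A \is a fin_num by exact: fin_num_measure.
have -> : posterior mu K A - posterior mu L A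
    = \int[posterior mu K]_t (Q t)%:E - \int[posterior mu L]_t (Q t)%:E.
  rewrite !QE// -(fineK (fin K)) -(fineK (fin L)) -!EFinB.
  by congr EFin; ring.
by apply: expectation_dist => //; apply: nearW.
Qed.

Lemma hellinger_dist_posterior K L e : (0 <= e)%R ->
  {ae mu, forall t, (`|K t - L t| <= e)%R} -> 0 < evidence mu L < +oo ->
  hellinger_dist mu (posterior mu K) (posterior mu L)
  <= ((Num.sqrt 2)^-1 * (expR e - 1))%:E.
Proof.
move=> e0 KL hL; have hK := evidence_pos_fin KL hL.
have c0 : (0 <= expR e - 1 :> R)%R by rewrite subr_ge0 expR_ge1.
rewrite /hellinger_dist.
pose rn J := Radon_Nikodym (charge_of_finite_measure (posterior mu J)) mu.
(* The derivatives are finite everywhere, so the extended square roots can be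
   replaced by real ones. *)
have rnE J t : sqrte (rn J t) = (Num.sqrt (fine (rn J t)))%:E.
  have : rn J t \is a fin_num.
    by apply: Radon_Nikodym_fin_num; exact: posterior_dominates.
  by case: (rn J t).
have mrn J : measurable_fun setT (fun t => Num.sqrt (fine (rn J t))).
  apply: (@measurableT_comp _ _ _ _ _ _ (@Num.sqrt R)).
    by apply: continuous_measurable_fun; exact: sqrt_continuous.
  apply: measurableT_comp => //; apply: measurable_int.
  by apply: Radon_Nikodym_integrable; exact: posterior_dominates.
rewrite -/(rn K) -/(rn L).
have H2 : \int[mu]_t (sqrte (rn K t) - sqrte (rn L t)) ^+ 2
    <= ((expR e - 1) ^+ 2)%:E.
  under eq_integral do rewrite !rnE -EFinB -EFin_expe.
  rewrite -[leRHS]mule1 -(integral_posterior_density hL) -ge0_integralZl//.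
  - apply: ae_ge0_le_integral => //.
    + by move=> t _; rewrite lee_fin sqr_ge0.
    + apply/measurable_EFinP; apply: measurable_funX.
      exact: measurable_funB.
    + by move=> t _; rewrite -EFinM lee_fin mulr_ge0 ?sqr_ge0
        ?posterior_density_ge0.
    + apply: measurable_funeM; apply/measurable_EFinP.
      exact: measurable_posterior_density.
    + apply: filterS3 (@Radon_Nikodym_posterior _ _ _ mu K)
        (@Radon_Nikodym_posterior _ _ _ mu L)
        (sqrt_posterior_density_dist e0 KL hL).
      move=> t /= /(_ I) rK /(_ I) rL st _.
      rewrite /rn rK rL -EFinM lee_fin /=.
      rewrite -[X in (_ <= _ * X)%R]sqr_sqrtr ?posterior_density_ge0//.
      by rewrite -exprMn -real_normK ?num_real// lerXn2r// nnegrE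
        ?mulr_ge0 ?sqrtr_ge0.
  - by apply/measurable_EFinP; exact: measurable_posterior_density.
  - by move=> t _; rewrite lee_fin posterior_density_ge0.
  - by rewrite lee_fin sqr_ge0.
apply: (@le_trans _ _ (sqrte ((2^-1)%:E * ((expR e - 1) ^+ 2)%:E))).
  rewrite lee_sqrt; last by rewrite -EFinM lee_fin mulr_ge0 ?sqr_ge0 ?invr_ge0.
  by rewrite lee_pmul2l.
by rewrite -EFinM /= sqrtrM ?invr_ge0// sqrtrV// sqrtr_sqr ger0_norm.
Qed.

End stability.

Theorem theorem2p5 (d : measure_display) (T : measurableType d) (R : realType)
    (mu0 : probability T R)
    (LN : nat -> {mfun T >-> R}) (L : {mfun T >-> R}) (eps : nat -> R)
    (eps_ge0 : forall N, (0 <= eps N)%R)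
    (LN_close : forall N,
      'N[mu0]_+oo[EFin \o (fun t => LN N t - L t)%R] <= (eps N)%:E)
    (Z_pos_fin : 0 < evidence mu0 L < +oo) (N : nat) :
  [/\ 0 < evidence mu0 (LN N) < +oo,
      (expR (- eps N)
        <= fine (evidence mu0 (LN N)) / fine (evidence mu0 L)
        <= expR (eps N))%R,
      tv_dist (posterior mu0 (LN N)) (posterior mu0 L)
        <= (2^-1 * (expR (2 * eps N) - 1))%:E,
      hellinger_dist mu0 (posterior mu0 (LN N)) (posterior mu0 L)
        <= ((Num.sqrt 2)^-1 * (expR (eps N) - 1))%:E
    & forall Q : {mfun T >-> R}, bounded_fun Q ->
        `| \int[posterior mu0 (LN N)]_t (Q t)%:E
           - \int[posterior mu0 L]_t (Q t)%:E |
        <= 'N[mu0]_+oo[EFin \o Q] * (expR (2 * eps N) - 1)%:E].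
Proof.
have LNL := ae_Lnormy_le (LN_close N).
split.
- exact: (evidence_pos_fin LNL Z_pos_fin).
- exact: evidence_ratio.
- exact: tv_dist_posterior.
- exact: hellinger_dist_posterior.
move=> Q bQ.
have Qfin := Lnormy_fin_num mu0 bQ.
rewrite -(fineK Qfin) -EFinM; apply: expectation_dist => //.
  by rewrite fine_ge0 ?Lnorm_ge0.
by apply: ae_Lnormy_le; rewrite fineK.
Qed.
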